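(* Suppose $\mathcal B\subseteq\mathbb R^k$ is polyhedral and the observed law $P^{\mathrm{obs}}$ of $(Y,X)$ has finite support. Let $\mathcal F$ be the collection of relatively open faces, of every dimension, induced on $\mathcal B$ by the residual-tie hyperplanes $$H_{mjt,hs}=\{b\in\mathbb R^k:(x_t^m-x_s^m)'b=y_t^{mj}-y_s^{mh}\}$$ (over all paths $m$, outcome support points $j,h$ of path $m$, and periods $t,s$). Then for each $F\in\mathcal F$: the feasibility status of the pathwise primal LPs, and the values of $\delta$ and $\mathcal L=-\delta$, are constant in $b$ on $F$. Moreover, for any choice of one point $b_F\in F$ for each $F\in\mathcal F$, $$\Theta_I=\bigcup_{F\in\mathcal F:\ \delta(b_F)=0}F.$$
   Context: $T,k\ge1$ are fixed integers, $\tau\in(0,1)$. $Y\in\mathbb R^T$, $X=(X_1,\dots,X_T)$, $X_t\in\mathbb R^k$. $x^1,\dots,x^M$ are the paths with $\pi_m=P^{\mathrm{obs}}(X=x^m)>0$, and given $X=x^m$ the outcome vector takes the distinct values $y^{m1},\dots,y^{mJ_m}\in\mathbb R^T$ with probabilities $p_{mj}>0$. Faces: write $\mathcal B=\{b:c_i'b\le e_i,\ i=1,\dots,I\}$. Two points of $\mathcal B$ belong to the same relatively open face if they give the same sign in $\{-,0,+\}$ to every $(x_t^m-x_s^m)'b-(y_t^{mj}-y_s^{mh})$ and to every $c_i'b-e_i$; $\mathcal F$ is the set of nonempty equivalence classes. Pathwise programs: for path $m$ and $b$, put $z_{mjt}(b)=y_t^{mj}-(x_t^m)'b$ and let $v_1<\dots<v_P$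 ($P$ depending on $m,b$) be the distinct values of $z_{mjt}(b)$ over $j,t$. The pathwise primal LP asks for $q_{jp}\ge0$ with $\sum_pq_{jp}=p_{mj}$ for all $j$ and, for all $p,t$, $\sum_{j:z_{mjt}(b)\le v_p}q_{jp}\ge\tau\sum_jq_{jp}$ and $\sum_{j:z_{mjt}(b)<v_p}q_{jp}\le\tau\sum_jq_{jp}$. The pathwise dual value is $$\delta_{x^m}(b)=\min\Big\{\sum_jp_{mj}\max_{p}s_{jp}(b;\lambda):\ \lambda_{pt}^\pm\ge0,\ \sum_{p,t}(\lambda_{pt}^-+\lambda_{pt}^+)\le1\Big\},$$ $$s_{jp}(b;\lambda)=\sum_{t=1}^T\big[\lambda_{pt}^-\{\mathbf 1(z_{mjt}(b)\le v_p)-\tau\}+\lambda_{pt}^+\{\tau-\mathbf 1(z_{mjt}(b)<v_p)\}\big].$$ Set $\delta(b)=\sum_{m=1}^M\pi_m\delta_{x^m}(b)$ and $\mathcal L(b)=-\delta(b)$. Identified set: $\Theta_I$ is the set of $b\in\mathcal B$ for which there exists a Borel probability law $P^{\mathrm s}$ of $(Y,X,A,U)$, $A\in\mathbb R$, $U\in\mathbb R^T$, with $(Y,X)$-marginal $P^{\mathrm{obs}}$, with $Y_t=X_t'b+A+U_t$ a.s. for all $t$, and with $P^{\mathrm s}(U_t\le0\mid X,A)\ge\tau$, $P^{\mathrm s}(U_t<0\mid X,A)\le\tau$ a.s. for all $t$. *)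

(* Defs.v *)
From HB Require Import structures.
From mathcomp Require Import all_boot all_order all_algebra.
From mathcomp Require Import all_classical all_reals all_analysis.

Set Implicit Arguments.
Unset Strict Implicit.
Unset Printing Implicit Defensive.
Import Order.TTheory GRing.Theory Num.Theory.

Local Open Scope classical_set_scope.
Local Open Scope ring_scope.

(* Vectors of R^n are n-tuples: the library equips them with the product of the
   Borel sigma-algebras of R, which is the Borel sigma-algebra of R^n. *)

Definition dot (R : realType) (k : nat) (u : 'I_k -> R) (b : k.-tuple R) : R :=
  \sum_(l < k) u l * tnth b l.

Definition polyhedron (R : realType) (k I : nat) (c : 'I_I -> k.-tuple R)
    (e : 'I_I -> R) : set (k.-tuple R) :=
  [set b | forall i, dot (tnth (c i)) b <= e i].

Section observed_law.
Variables (R : realType) (T k : nat).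

(* Values of (Y, X), with X = (X_1, ..., X_T) and X_t in R^k. *)
Definition observation := (T.-tuple R * T.-tuple (k.-tuple R))%type.

Variable Pobs : probability observation R.

Definition has_finite_support : Prop :=
  exists2 S : set observation, finite_set S & Pobs S = 1%E.

Definition path_prob (x : T.-tuple (k.-tuple R)) : R :=
  fine (Pobs [set w | w.2 = x]).

(* P(Y = y | X = x); only meaningful when path_prob x > 0. *)
Definition outcome_prob (x : T.-tuple (k.-tuple R)) (y : T.-tuple R) : R :=
  fine (Pobs [set w | w.2 = x /\ w.1 = y]) / path_prob x.

(* A numbering x^1, ..., x^M of the paths of positive probability and, for each
   path m, a numbering y^{m1}, ..., y^{mJ_m} of its outcome vectors. *)
Record support_numbering := SupportNumbering {
  npaths : nat;
  xpath : 'I_npaths -> T.-tuple (k.-tuple R);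
  xpath_inj : injective xpath;
  xpath_pos : forall x, 0 < path_prob x <-> exists m, xpath m = x;
  nouts : 'I_npaths -> nat;
  outs : forall m, 'I_(nouts m) -> T.-tuple R;
  outs_inj : forall m, injective (@outs m);
  outs_pos : forall m y,
    0 < outcome_prob (xpath m) y <-> exists j, @outs m j = y }.

End observed_law.

Arguments xpath {R T k Pobs} s m.
Arguments outs {R T k Pobs} s m j.

Section pathwise_programs.
Variables (R : realType) (T k : nat) (tau : R).
(* One path x, its outcome vectors y_j and their conditional probabilities p_j. *)
Variables (x : T.-tuple (k.-tuple R)) (J : nat).
Variables (y : 'I_J -> T.-tuple R) (p : 'I_J -> R).
Variable b : k.-tuple R.

Definition resid (j : 'I_J) (t : 'I_T) : R :=
  tnth (y j) t - dot (tnth (tnth x t)) b.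

Definition levels : seq R :=
  sort <=%R (undup [seq resid jt.1 jt.2 | jt : 'I_J * 'I_T]).

Definition nlevels := size levels.

Definition level (i : 'I_nlevels) : R := levels`_i.

Definition primal_feasible : Prop :=
  exists q : 'M[R]_(J, nlevels),
    [/\ forall j i, 0 <= q j i,
        forall j, \sum_i q j i = p j,
        forall i t, tau * \sum_j q j i
                    <= \sum_(j | resid j t <= level i) q j i &
        forall i t, \sum_(j | resid j t < level i) q j i
                    <= tau * \sum_j q j i].

Definition dual_feasible (lm lp : 'M[R]_(nlevels, T)) : Prop :=
  [/\ forall i t, 0 <= lm i t,
      forall i t, 0 <= lp i t &
      \sum_i \sum_t (lm i t + lp i t) <= 1].

Definition score (lm lp : 'M[R]_(nlevels, T)) (j : 'I_J) (i : 'I_nlevels) : R :=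
  \sum_t (lm i t * ((resid j t <= level i)%R%:R - tau)
          + lp i t * (tau - (resid j t < level i)%R%:R)).

(* The supremum is over finitely many indices, hence a maximum. *)
Definition dual_objective (lm lp : 'M[R]_(nlevels, T)) : R :=
  \sum_j p j * sup (range (score lm lp j)).

(* The infimum is a minimum: the objective is continuous in (lm, lp) and the
   feasible set is compact and contains 0. *)
Definition dual_value : R :=
  inf [set dual_objective l.1 l.2 | l in [set l | dual_feasible l.1 l.2]].

End pathwise_programs.

Section criterion.
Variables (R : realType) (T k : nat) (tau : R).
Variables (Pobs : probability (observation R T k) R).
Variable (N : support_numbering Pobs).

Definition path_primal_feasible (m : 'I_(npaths N)) (b : k.-tuple R) : Prop :=
  primal_feasible tau (xpath N m) (outs N m)
    (fun j => outcome_prob Pobs (xpath N m) (outs N m j)) b.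

Definition path_dual_value (m : 'I_(npaths N)) (b : k.-tuple R) : R :=
  dual_value tau (xpath N m) (outs N m)
    (fun j => outcome_prob Pobs (xpath N m) (outs N m j)) b.

Definition delta (b : k.-tuple R) : R :=
  \sum_m path_prob Pobs (xpath N m) * path_dual_value m b.

Definition criterion (b : k.-tuple R) : R := - delta b.

End criterion.

Section faces.
Variables (R : realType) (T k : nat) (Pobs : probability (observation R T k) R).
Variables (N : support_numbering Pobs).
Variables (I : nat) (c : 'I_I -> k.-tuple R) (e : 'I_I -> R).

(* (x_t^m - x_s^m)'b - (y_t^{mj} - y_s^{mh}); its zero set is H_{mjt,hs}. *)
Definition tie_form (m : 'I_(npaths N)) (j h : 'I_(nouts m)) (t s : 'I_T)
    (b : k.-tuple R) : R :=
  dot (fun l => tnth (tnth (xpath N m) t) l - tnth (tnth (xpath N m) s) l) b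
  - (tnth (outs N m j) t - tnth (outs N m h) s).

Definition same_face (b b' : k.-tuple R) : Prop :=
  (forall m (j h : 'I_(nouts m)) (t s : 'I_T),
     Num.sg (tie_form j h t s b) = Num.sg (tie_form j h t s b')) /\
  (forall i, Num.sg (dot (tnth (c i)) b - e i)
             = Num.sg (dot (tnth (c i)) b' - e i)).

Definition faces : set (set (k.-tuple R)) :=
  [set F | exists2 b, polyhedron c e b &
     F = [set b' | polyhedron c e b' /\ same_face b b']].

End faces.

(* g is a version of w |-> P(E | W = w): g(W) is a version of P(E | W). *)
Definition cond_prob_version (R : realType) (d d' : measure_display)
    (Om : measurableType d) (S : measurableType d') (P : probability Om R)
    (E : set Om) (W : Om -> S) (g : S -> R) : Prop :=
  [/\ measurable_fun setT g,
      P.-integrable setT (fun w => (g (W w))%:E) &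
      forall B, measurable B ->
        (\int[P]_(w in W @^-1` B) (g (W w))%:E = P (E `&` W @^-1` B))%E].

Section identified_set.
Variables (R : realType) (T k : nat) (tau : R).
Variable Pobs : probability (observation R T k) R.

(* Values of ((Y, X), (A, U)). *)
Definition structural := (observation R T k * (R * T.-tuple R))%type.

Definition coordY (w : structural) : T.-tuple R := w.1.1.
Definition coordX (w : structural) : T.-tuple (k.-tuple R) := w.1.2.
Definition coordA (w : structural) : R := w.2.1.
Definition coordU (w : structural) : T.-tuple R := w.2.2.
Definition coordXA (w : structural) : T.-tuple (k.-tuple R) * R :=
  (coordX w, coordA w).

(* Conditional probabilities are unique up to null sets, so asking for one
   version satisfying an almost sure bound is the same as asking for all. *)
Definition rationalizes (b : k.-tuple R) (Ps : probability structural R)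
    : Prop :=
  [/\ forall B, measurable B -> Ps (fst @^-1` B) = Pobs B,
      forall t, {ae Ps, forall w, tnth (coordY w) t =
        dot (tnth (tnth (coordX w) t)) b + coordA w + tnth (coordU w) t},
      forall t, exists g : T.-tuple (k.-tuple R) * R -> R,
        cond_prob_version Ps [set w | tnth (coordU w) t <= 0] coordXA g /\
        {ae Ps, forall w, tau <= g (coordXA w)} &
      forall t, exists g : T.-tuple (k.-tuple R) * R -> R,
        cond_prob_version Ps [set w | tnth (coordU w) t < 0] coordXA g /\
        {ae Ps, forall w, g (coordXA w) <= tau}].

Definition identified_set (B : set (k.-tuple R)) : set (k.-tuple R) :=
  [set b | B b /\ exists Ps, rationalizes b Ps].

End identified_set.

(* Main.v *)
Require Import Defs.
From HB Require Import structures.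
From mathcomp Require Import all_boot all_order all_algebra.
From mathcomp Require Import all_classical all_reals all_analysis.
From mathcomp Require Import measurable_realfun ring lra.

Set Implicit Arguments.
Unset Strict Implicit.
Unset Printing Implicit Defensive.
Import Order.TTheory GRing.Theory Num.Theory.

Local Open Scope classical_set_scope.
Local Open Scope ring_scope.

(* The signs that define a face fix the order of the residuals of each path, and
   the pathwise programs depend on b only through that order.  By
   Fourier-Motzkin elimination (Farkas), the pathwise primal is feasible iff the
   dual objective is nonnegative, i.e. iff the dual value is 0; since dual values
   are nonpositive and path probabilities positive, delta(b) = 0 iff all the
   pathwise primals are feasible.

   A version of P(U_t <= 0 | X, A) is >= tau almost surely iff
   P(U_t <= 0, (X, A) in B) >= tau P((X, A) in B) for all Borel B, and similarly
   for the other restriction.  Given a rationalizing law, rounding A down to the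
   nearest level turns these inequalities into the primal constraints for
   q_jp = P(Y = y_j, A in [v_p, v_(p+1)) | X = x).  Conversely a primal solution q
   yields the finitely supported law under which (Y, A) = (y_j, v_p) has
   conditional probability q_jp given X = x. *)

(** * Linear inequalities *)

(** The largest lower bound serves as [x]; with no lower bound at all, the smallest upper bound
    does. An empty side imposes nothing, hence the case split. *)
Lemma finite_separation (R : realFieldType) (C : finType) (P Q : pred C)
    (l u : C -> R) :
  (forall i j, P i -> Q j -> l i <= u j) ->
  exists x, (forall i, P i -> l i <= x) /\ (forall j, Q j -> x <= u j).
Proof.
move=> lu; case: (pickP P) => [i0 Pi0|P0].
  exists (l [arg max_(i > i0 | P i) l i]%O).
  by case: Order.TotalTheory.arg_maxP => // i Pi li; split=> // j; apply: lu.
case: (pickP Q) => [j0 Qj0|Q0].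
  exists (u [arg min_(j < j0 | Q j) u j]%O).
  case: Order.TotalTheory.arg_minP => // j Qj uj; split=> // i.
  by rewrite P0.
by exists 0; split=> i; rewrite ?P0 ?Q0.
Qed.

(* Fourier-Motzkin elimination: the pair (i, j) stands for the combination of
   the constraints i and j in which the eliminated variable cancels. *)
Lemma gale_ord (R : realFieldType) n (C : finType) (a : C -> 'I_n -> R)
    (d : C -> R) :
  (exists x : 'I_n -> R, forall i, \sum_k a i k * x k <= d i) \/
  (exists w : C -> R, [/\ forall i, 0 <= w i, forall k, \sum_i w i * a i k = 0
     & \sum_i w i * d i < 0]).
Proof.
elim: n C a d => [|n IH] C a d.
  case: (pickP (fun i => d i < 0)) => [i di|d0]; last first.
    by left; exists (fun=> 0) => i; rewrite big_ord0 leNgt d0.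
  right; exists (fun j => (j == i)%:R); split=> [j||]; rewrite ?ler0n//.
    by case.
  by rewrite (bigD1 i)//= eqxx mul1r big1 ?addr0// => j /negPf->; rewrite mul0r.
pose a0 i := a i ord0.
(* A pair with coefficients of signs (+, -) is cross-multiplied to cancel the variable. Any other
   pair keeps its first constraint when that one does not involve the variable, and otherwise
   degenerates to [0 <= 0]. *)
pose u (z : C * C) := if (0 < a0 z.1) && (a0 z.2 < 0) then - a0 z.2
                      else (a0 z.1 == 0)%:R.
pose v (z : C * C) := if (0 < a0 z.1) && (a0 z.2 < 0) then a0 z.1 else 0.
have u0 z : 0 <= u z.
  by rewrite /u; case: ifPn => [/andP[_ /ltW]|_]; rewrite ?oppr_ge0 ?ler0n.
have v0 z : 0 <= v z by rewrite /v; case: ifPn => [/andP[/ltW]|].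
have uv z : u z * a0 z.1 + v z * a0 z.2 = 0.
  rewrite /u /v; case: ifPn => [_|_]; first by ring.
  by case: eqP => [->|_]; rewrite ?mulr0 ?mul0r addr0.
pose comb (f : C -> R) z := u z * f z.1 + v z * f z.2.
have [[x Hx]|[w [w0 wa wd]]] := IH (C * C)%type
    (fun z k => comb (fun i => a i (lift ord0 k)) z) (comb d).
  (* Constraint [i] now reads [a0 i * x0 <= r i]: it bounds the eliminated variable [x0] from above
     or below according to the sign of [a0 i]. *)
  left; pose r i := d i - \sum_k a i (lift ord0 k) * x k.
  have rP z : 0 <= comb r z.
    have := Hx z; rewrite -subr_ge0; congr (_ <= _).
    rewrite /comb /r.
    under eq_bigr do rewrite mulrDl -!mulrA.
    by rewrite big_split/= -!mulr_sumr; ring.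
  have [|x0 [x0l x0u]] := @finite_separation R C (fun i => a0 i < 0)
      (fun i => 0 < a0 i) (fun i => r i / a0 i) (fun i => r i / a0 i).
    move=> i j ai aj; have := rP (j, i); rewrite /comb/u/v /= ai aj /= => h.
    rewrite ler_pdivlMr// mulrAC ler_ndivrMr//.
    by lra.
  exists (fun k => if unlift ord0 k is Some k' then x k' else x0) => i.
  rewrite big_ord_recl unlift_none.
  under eq_bigr do rewrite liftK.
  rewrite -lerBrDr -/(r i) -/(a0 i).
  have [ai|ai|ai] := ltgtP (a0 i) 0.
  - by move: (x0l i ai); rewrite ler_ndivrMr// mulrC.
  - by move: (x0u i ai); rewrite ler_pdivlMr// mulrC.
  (* A constraint free of [x0] survives the elimination as the diagonal pair. *)
  - have := rP (i, i).
    by rewrite /comb /u /v/= ai ltxx eqxx/= mul0r mul1r mul0r addr0.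
right.
(* Infeasibility certificates pull back: constraint [i] collects the weight of every pair in which
   it occurs, in either position. *)
exists (fun i => \sum_j w (i, j) * u (i, j) + \sum_j w (j, i) * v (j, i)).
have E f : \sum_i (\sum_j w (i, j) * u (i, j) + \sum_j w (j, i) * v (j, i)) * f i
         = \sum_z w z * comb f z.
  under eq_bigr do rewrite mulrDl !mulr_suml.
  rewrite big_split/= [X in _ + X]exchange_big !pair_bigA/= -big_split/=.
  by apply: eq_bigr => -[i j] _ /=; rewrite /comb/=; ring.
split=> [i|k|]; rewrite ?E//.
  by rewrite addr_ge0// sumr_ge0// => j _; rewrite mulr_ge0.
case: (unliftP ord0 k) => [k' ->|->]; first exact: wa.
by apply: big1 => z _; rewrite /comb uv mulr0.
Qed.

Lemma gale (R : realFieldType) (V C : finType) (a : C -> V -> R) (d : C -> R) :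
  (exists x : V -> R, forall i, \sum_k a i k * x k <= d i) \/
  (exists w : C -> R, [/\ forall i, 0 <= w i, forall k, \sum_i w i * a i k = 0
     & \sum_i w i * d i < 0]).
Proof.
have [[x Hx]|[w [w0 wa wd]]] :=
  gale_ord (fun i (k : 'I_#|V|) => a i (enum_val k)) d.
  left; exists (x \o enum_rank) => i; apply: le_trans (Hx i).
  rewrite (reindex (@enum_val V predT)); last by apply/onW_bij/enum_val_bij.
  by under eq_bigr do rewrite /= enum_valK.
right; exists w; split=> // k; have := wa (enum_rank k).
by under eq_bigr do rewrite enum_rankK.
Qed.

(** Gale's alternative for the unknown plan [q]. The function [m] is the multiplier of the row-sum
    equations, so it carries no sign; the multipliers of [0 <= q j i] are absorbed as slack in
    [\sum_l w l * c l j i <= m j]. *)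
Lemma transport_alternative (R : realFieldType) (J V K : finType) (p : J -> R)
    (c : K -> J -> V -> R) :
  (exists q : J -> V -> R, [/\ forall j i, 0 <= q j i,
     forall j, \sum_i q j i = p j &
     forall l, 0 <= \sum_j \sum_i c l j i * q j i]) \/
  (exists (w : K -> R) (m : J -> R), [/\ forall l, 0 <= w l,
     forall j i, \sum_l w l * c l j i <= m j & \sum_j p j * m j < 0]).
Proof.
(* The four kinds of rows are: nonnegativity of [q], each row sum as an upper and as a lower bound,
   and the constraints in [K]. *)
pose a (s : (J * V) + (J + J) + K) (z : J * V) : R := match s with
  | inl (inl z') => - (z == z')%:R
  | inl (inr (inl j)) => (z.1 == j)%:R
  | inl (inr (inr j)) => - (z.1 == j)%:R
  | inr l => - c l z.1 z.2 end.
pose d (s : (J * V) + (J + J) + K) : R := match s with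
  | inl (inr (inl j)) => p j
  | inl (inr (inr j)) => - p j
  | _ => 0 end.
have delta_sum (z : J * V) (F : J * V -> R) :
    \sum_z' (z' == z)%:R * F z' = F z.
  rewrite (bigD1 z)//= eqxx mul1r big1 ?addr0// => z' /negPf->.
  by rewrite mul0r.
have delta_sum1 (j : J) (F : J -> R) : \sum_j' (j == j')%:R * F j' = F j.
  rewrite (bigD1 j)//= eqxx mul1r big1 ?addr0// => j' /negPf.
  by rewrite eq_sym => ->; rewrite mul0r.
have row_sum j (F : J * V -> R) :
    \sum_z (z.1 == j)%:R * F z = \sum_i F (j, i).
  transitivity (\sum_j' \sum_i (j' == j)%:R * F (j', i)).
    by rewrite pair_bigA; apply: eq_bigr => -[].
  under eq_bigr do rewrite -mulr_sumr eq_sym.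
  by rewrite (delta_sum1 _ (fun j => \sum_i F (j, i))).
have [[x Hx]|[w [w0 wa wd]]] := gale a d.
  left; exists (fun j i => x (j, i)); split=> [j i|j|l].
  - have := Hx (inl (inl (j, i))); rewrite /a/d/=.
    under eq_bigr do rewrite mulNr.
    by rewrite sumrN delta_sum oppr_le0.
  - apply/eqP; rewrite eq_le; apply/andP; split.
      by have := Hx (inl (inr (inl j))); rewrite /a/d/= row_sum.
    have := Hx (inl (inr (inr j))); rewrite /a/d/=.
    under eq_bigr do rewrite mulNr.
    by rewrite sumrN row_sum lerN2.
  - have := Hx (inr l); rewrite /a/d/= pair_bigA/=.
    under eq_bigr do rewrite mulNr.
    by rewrite sumrN oppr_le0; congr (_ <= _); apply: eq_bigr => -[].
right; exists (fun l => w (inr l)).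
exists (fun j => w (inl (inr (inl j))) - w (inl (inr (inr j)))).
split=> [//|j i|].
  have := wa (j, i); rewrite !big_sumType/= /a/=.
  under eq_bigr do rewrite mulrN mulrC eq_sym.
  under [X in _ + (X + _) + _]eq_bigr do rewrite mulrC.
  under [X in _ + (_ + X) + _]eq_bigr do rewrite mulrN mulrC.
  under [X in _ + X]eq_bigr do rewrite mulrN.
  rewrite !sumrN !delta_sum1 (delta_sum _ (fun z => w (inl (inl z)))) => h.
  by have := w0 (inl (inl (j, i))); lra.
move: wd; rewrite !big_sumType/= /d/=.
rewrite big1 => [|? _]; last by rewrite mulr0.
rewrite [X in _ + _ + X]big1 => [|? _]; last by rewrite mulr0.
rewrite add0r addr0 -big_split/=; congr (_ < _).
by apply: eq_bigr => j _; ring.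
Qed.

(** * Duality of the pathwise programs *)

Lemma has_ubound_range_ord (R : realType) n (f : 'I_n -> R) :
  has_ubound (range f).
Proof.
exists (\sum_i `|f i|) => _ [i _ <-].
by rewrite (bigD1 i)//= (le_trans (ler_norm _))// lerDl sumr_ge0.
Qed.

Lemma le_sup_range_ord (R : realType) n (f : 'I_n -> R) i :
  f i <= sup (range f).
Proof. by apply: ub_le_sup; [exact: has_ubound_range_ord|exists i]. Qed.

Lemma sup_range_ord_le (R : realType) n (f : 'I_n -> R) (a : R) : (0 < n)%N ->
  (forall i, f i <= a) -> sup (range f) <= a.
Proof.
move=> n0 fa; apply: ge_sup; first by exists (f (Ordinal n0)), (Ordinal n0).
by move=> _ [i _ <-].
Qed.

Section duality.
Variables (R : realType) (T k : nat) (tau : R) (x : T.-tuple (k.-tuple R)).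
Variables (J : nat) (y : 'I_J -> T.-tuple R) (p : 'I_J -> R).
Variable b : k.-tuple R.
Hypothesis p_ge0 : forall j, 0 <= p j.
Hypothesis nlevels_gt0 : (0 < nlevels x y b)%N.

Let n := nlevels x y b.

(** A triple [l] names a level, a period and one of the two quantile constraints: [false] goes with
    the weak inequality and the multiplier [lm], [true] with the strict one and [lp]. *)
Let coef (l : 'I_n * 'I_T * bool) (j : 'I_J) (i : 'I_n) : R :=
  (i == l.1.1)%:R *
  (if l.2 then tau - (resid x y b j l.1.2 < level l.1.1)%R%:R
   else (resid x y b j l.1.2 <= level l.1.1)%R%:R - tau).

Let coefE (q : 'I_J -> 'I_n -> R) l : \sum_j \sum_i coef l j i * q j i =
  \sum_j (if l.2 then tau - (resid x y b j l.1.2 < level l.1.1)%R%:R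
   else (resid x y b j l.1.2 <= level l.1.1)%R%:R - tau) * q j l.1.1.
Proof.
apply: eq_bigr => j _; rewrite (bigD1 l.1.1)//= big1 ?addr0 => [|i /negPf il].
  by rewrite /coef eqxx mul1r.
by rewrite /coef il !mul0r.
Qed.

Let score_coef (w : 'I_n * 'I_T * bool -> R) j i :
  score tau (\matrix_(i, t) w (i, t, false)) (\matrix_(i, t) w (i, t, true)) j i
  = \sum_l w l * coef l j i.
Proof.
transitivity (\sum_i' \sum_t \sum_s w (i', t, s) * coef (i', t, s) j i).
  rewrite (bigD1 i)//= [X in _ + X]big1 ?addr0 => [|i' /negPf ii'].
    by apply: eq_bigr => t _; rewrite big_bool/= !mxE /coef /= eqxx !mul1r addrC.
  by rewrite !big1 => // t _; rewrite big1 => // s _;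
    rewrite /coef /= eq_sym ii' !mul0r mulr0.
by rewrite !pair_bigA/=; apply: eq_bigr => -[[]].
Qed.

(** Here the multipliers range over a whole cone, without the bound on their sum, so that the
    alternative for [q] applies directly. *)
Lemma primal_feasible_dual_ge0 : primal_feasible tau x y p b <->
  forall lm lp : 'M[R]_(n, T), (forall i t, 0 <= lm i t) ->
    (forall i t, 0 <= lp i t) -> 0 <= dual_objective tau p lm lp.
Proof.
have sumB (P : pred 'I_J) (f : 'I_J -> R) :
    \sum_(j | P j) f j - tau * \sum_j f j = \sum_j ((P j)%:R - tau) * f j.
  rewrite mulr_sumr big_mkcond -sumrB; apply: eq_bigr => j _.
  by case: (P j); rewrite mulrBl ?mul1r ?mul0r.
split=> [[q [q0 qp qm qM]] lm lp lm0 lp0|H].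
  (* Weak duality: the maximal score of outcome [j], times [p j], dominates the scores weighted by
     row [j] of [q], whose total is [p j]. *)
  apply: (@le_trans _ _ (\sum_j \sum_i q j i * score tau lm lp j i)).
    rewrite exchange_big/= sumr_ge0// => i _.
    under eq_bigr do rewrite /score mulr_sumr.
    rewrite exchange_big/= sumr_ge0// => t _.
    under eq_bigr do rewrite mulrDr (mulrCA _ (lm i t)) (mulrCA _ (lp i t)).
    rewrite big_split/= -!mulr_sumr addr_ge0// mulr_ge0//.
      under eq_bigr do rewrite mulrC.
      by rewrite -sumB subr_ge0.
    under eq_bigr do rewrite mulrC -opprB mulNr.
    by rewrite sumrN -sumB opprB subr_ge0.
  apply: ler_sum => j _; rewrite -qp mulr_suml; apply: ler_sum => i _.
  by rewrite ler_wpM2l// le_sup_range_ord.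
have [[q [q0 qp qc]]|[w [m [w0 wm mp]]]] := transport_alternative p coef.
  exists (\matrix_(j, i) q j i); split=> [j i|j|i t|i t].
  - by rewrite mxE.
  - by under eq_bigr do rewrite mxE.
  - rewrite -subr_ge0 sumB; have := qc (i, t, false); rewrite coefE/=.
    by under [X in _ -> is_true (0 <= X)]eq_bigr do rewrite mxE.
  - rewrite -subr_ge0 -opprB sumB; have := qc (i, t, true); rewrite coefE/=.
    under [X in _ -> is_true (0 <= - X)]eq_bigr do rewrite mxE.
    rewrite -sumrN; congr (_ <= _); apply: eq_bigr => j _.
    by rewrite -mulNr opprB.
have /= := H (\matrix_(i, t) w (i, t, false)) (\matrix_(i, t) w (i, t, true)).
move=> /(_ _ _)/wrap[|i t|]; first by move=> i t; rewrite mxE.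
  by rewrite mxE.
(* The certificate [m j] bounds all scores of [j], hence their maximum, so the dual objective at [w]
   is at most [\sum_j p j * m j < 0]. *)
rewrite leNgt => /negP[]; apply: le_lt_trans mp.
apply: ler_sum => j _; rewrite ler_wpM2l// sup_range_ord_le// => i.
by rewrite score_coef.
Qed.

Hypotheses (tau_ge0 : 0 <= tau) (tau_le1 : tau <= 1).

(** Both brackets in the score are at least -1 and the multipliers sum to at most 1. This bounds the
    dual values from below, as the use of [inf] requires. *)
Lemma score_geN1 (lm lp : 'M[R]_(n, T)) j i :
  dual_feasible lm lp -> -1 <= score tau lm lp j i.
Proof.
move=> [lm0 lp0 lS]; apply: (@le_trans _ _ (- \sum_t (lm i t + lp i t))).
  rewrite lerN2 (le_trans _ lS)// (bigD1 i)//= lerDl.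
  by rewrite sumr_ge0// => i' _; rewrite sumr_ge0// => t _; rewrite addr_ge0.
rewrite -sumrN; apply: ler_sum => t _.
rewrite opprD lerD//.
  by rewrite -mulrN1 ler_wpM2l// -[-1]sub0r lerB ?ler0n.
rewrite -(mulrN1 (lp i t)) ler_wpM2l// -[-1]sub0r lerB ?lern1 ?leq_b1//.
Qed.

Lemma dual_feasible0 : dual_feasible (0 : 'M[R]_(n, T)) 0.
Proof.
split=> [i t|i t|]; rewrite ?mxE//.
by rewrite big1 ?ler01// => i _; rewrite big1// => t _; rewrite !mxE addr0.
Qed.

Lemma dual_objective0 : dual_objective tau p (0 : 'M[R]_(n, T)) 0 = 0.
Proof.
have s0 j i : score tau (0 : 'M[R]_(n, T)) 0 j i = 0.
  by rewrite /score big1// => t _; rewrite !mxE !mul0r addr0.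
apply: big1 => j _; rewrite [X in _ * X](_ : _ = 0) ?mulr0//.
apply/eqP; rewrite eq_le.
rewrite sup_range_ord_le//=; last by move=> i; rewrite s0.
by rewrite -(s0 j (Ordinal nlevels_gt0)) le_sup_range_ord.
Qed.

Let dual_values :=
  [set dual_objective tau p l.1 l.2 | l in
     [set l : 'M[R]_(n, T) * 'M[R]_(n, T) | dual_feasible l.1 l.2]].

Let dual_values0 : dual_values 0.
Proof. by exists (0, 0); [exact: dual_feasible0|exact: dual_objective0]. Qed.

Let dual_values_lb : has_lbound dual_values.
Proof.
exists (- \sum_j p j) => _ [[lm lp] lmp <-]/=.
rewrite -sumrN; apply: ler_sum => j _; rewrite -mulrN1 ler_wpM2l//.
by rewrite (le_trans (score_geN1 j (Ordinal nlevels_gt0) lmp))// le_sup_range_ord.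
Qed.

Lemma dual_value_le0 : dual_value tau x y p b <= 0.
Proof. exact: ge_inf. Qed.

(** Half of positive homogeneity: it lets arbitrary nonnegative multipliers be rescaled into the
    dual feasible set. *)
Lemma dual_objectiveZ_le (a : R) (lm lp : 'M[R]_(n, T)) : 0 <= a ->
  dual_objective tau p (a *: lm) (a *: lp) <= a * dual_objective tau p lm lp.
Proof.
move=> a0; rewrite /dual_objective mulr_sumr; apply: ler_sum => j _.
rewrite mulrCA ler_wpM2l// sup_range_ord_le// => i.
apply: (@le_trans _ _ (a * score tau lm lp j i)); last first.
  by rewrite ler_wpM2l// le_sup_range_ord.
rewrite /score mulr_sumr le_eqVlt; apply/orP; left; apply/eqP.
by apply: eq_bigr => t _; rewrite !mxE; ring.
Qed.

Lemma dual_value_eq0 : dual_value tau x y p b = 0 <-> primal_feasible tau x y p b.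
Proof.
rewrite primal_feasible_dual_ge0; split=> [v0 lm lp lm0 lp0|H]; last first.
  apply/eqP; rewrite eq_le dual_value_le0/= lb_le_inf//; first by exists 0.
  by move=> _ [[lm lp] [lm0 lp0 _] <-]; exact: H.
(* The added 1 keeps the divisor positive when all multipliers vanish, and the rescaled total still
   stays below 1. *)
pose S := 1 + \sum_i \sum_t (lm i t + lp i t).
have S0 : 0 < S.
  rewrite ltr_pwDl// sumr_ge0// => i _; rewrite sumr_ge0// => t _.
  by rewrite addr_ge0.
rewrite -(pmulr_rge0 _ (_ : 0 < S^-1)) ?invr_gt0//.
apply: le_trans (dual_objectiveZ_le _ _ _); last by rewrite invr_ge0 ltW.
rewrite -v0; apply: ge_inf => //.
exists (S^-1 *: lm, S^-1 *: lp) => //; split=> [i t|i t|] /=.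
- by rewrite mxE mulr_ge0// invr_ge0 ltW.
- by rewrite mxE mulr_ge0// invr_ge0 ltW.
- under eq_bigr do under eq_bigr do rewrite !mxE -mulrDr.
  under eq_bigr do rewrite -mulr_sumr.
  by rewrite -mulr_sumr ler_pdivrMl// mulr1 /S lerDr.
Qed.

End duality.

(** * Invariance on faces *)

(** A strictly sorted list is determined by its members, and [h] is strictly increasing on the
    values of [f]. *)
Lemma sort_undup_image (R : realDomainType) (I : finType) (f g : I -> R)
    (h : R -> R) : (forall i, h (f i) = g i) ->
  (forall i j, (f i <= f j) = (g i <= g j)) ->
  sort <=%R (undup [seq g i | i : I]) =
  [seq h v | v <- sort <=%R (undup [seq f i | i : I])].
Proof.
move=> hf fg; apply: lt_sorted_eq.
- by rewrite sort_lt_sorted undup_uniq.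
- have : sorted <%R (sort <=%R (undup [seq f i | i : I])).
    by rewrite sort_lt_sorted undup_uniq.
  apply: (homo_sorted_in (P := mem [seq f i | i : I])); last first.
    by apply/allP => v; rewrite mem_sort mem_undup.
  move=> v w /fintype.imageP[i _ ->] /fintype.imageP[j _ ->].
  by rewrite !hf !ltNge fg.
- move=> v; rewrite mem_sort mem_undup; apply/fintype.imageP/mapP => [[i _ ->]|[w]].
    by exists (f i); rewrite ?hf// mem_sort mem_undup fintype.image_f.
  by rewrite mem_sort mem_undup => /fintype.imageP[i _ ->] ->; exists i; rewrite ?hf.
Qed.

Section order_invariance.
Variables (R : realType) (T k : nat) (tau : R) (x : T.-tuple (k.-tuple R)).
Variables (J : nat) (y : 'I_J -> T.-tuple R) (p : 'I_J -> R).

(* The pathwise programs see the residuals only through the number of levels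
   and the comparisons of residuals with levels, here [le] and [lt]. *)
Definition program_primal n (le lt : 'I_J -> 'I_T -> 'I_n -> bool) : Prop :=
  exists q : 'M[R]_(J, n),
    [/\ forall j i, 0 <= q j i,
        forall j, \sum_i q j i = p j,
        forall i t, tau * \sum_j q j i <= \sum_(j | le j t i) q j i &
        forall i t, \sum_(j | lt j t i) q j i <= tau * \sum_j q j i].

Definition program_dual n (le lt : 'I_J -> 'I_T -> 'I_n -> bool) : R :=
  inf [set \sum_j p j * sup (range (fun i =>
         \sum_t (l.1 i t * ((le j t i)%:R - tau)
                 + l.2 i t * (tau - (lt j t i)%:R)))) | l in
    [set l : 'M[R]_(n, T) * 'M[R]_(n, T) |
      [/\ forall i t, 0 <= l.1 i t, forall i t, 0 <= l.2 i t &
          \sum_i \sum_t (l.1 i t + l.2 i t) <= 1]]].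

Variables b b' : k.-tuple R.
Hypothesis same_order : forall j t h s,
  (resid x y b j t <= resid x y b h s) = (resid x y b' j t <= resid x y b' h s).

(** Carries levels at [b] to levels at [b']. Residuals tied at [b] are tied at [b'], so the choice
    made by [pick] is immaterial; 0 is a default off the levels. *)
Let h (v : R) : R :=
  if [pick z : 'I_J * 'I_T | resid x y b z.1 z.2 == v] is Some z
  then resid x y b' z.1 z.2 else 0.

Let hE j t : h (resid x y b j t) = resid x y b' j t.
Proof.
rewrite /h; case: pickP => [z /eqP bz|/(_ (j, t))]; last by rewrite eqxx.
by apply/eqP; rewrite eq_le -!same_order bz lexx.
Qed.

Let levelsE : levels x y b' = [seq h v | v <- levels x y b].
Proof. by apply: sort_undup_image => [[j t]|[j t] [l s]]; [exact: hE|]. Qed.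

Let nlevelsE : nlevels x y b' = nlevels x y b.
Proof. by rewrite /nlevels levelsE size_map. Qed.

Let nth_level (j : 'I_J) (t : 'I_T) i : (i < nlevels x y b)%N ->
  ((resid x y b' j t <= (levels x y b')`_i) =
   (resid x y b j t <= (levels x y b)`_i)) *
  ((resid x y b' j t < (levels x y b')`_i) =
   (resid x y b j t < (levels x y b)`_i)).
Proof.
move=> ib; have := mem_nth 0 ib; rewrite mem_sort mem_undup.
move=> /fintype.imageP[[l s] _ ls]; rewrite levelsE (nth_map 0)// ls/= hE.
by rewrite !ltNge !same_order.
Qed.

Lemma order_invariance :
  (primal_feasible tau x y p b <-> primal_feasible tau x y p b') /\
  dual_value tau x y p b = dual_value tau x y p b'.
Proof.
(* The size [n] is kept independent of [c], so that the equality of the numbers of levels can be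
   rewritten without casting matrices. *)
pose le c n (j : 'I_J) t (i : 'I_n) := resid x y c j t <= (levels x y c)`_i.
pose lt c n (j : 'I_J) t (i : 'I_n) := resid x y c j t < (levels x y c)`_i.
have pE c : primal_feasible tau x y p c =
    program_primal (le c (nlevels x y c)) (lt c (nlevels x y c)) by [].
have dE c : dual_value tau x y p c =
    program_dual (le c (nlevels x y c)) (lt c (nlevels x y c)) by [].
have leE : le b' (nlevels x y b) = le b (nlevels x y b).
  by apply/funext => j; apply/funext => t; apply/funext => i; rewrite /le nth_level.
have ltE : lt b' (nlevels x y b) = lt b (nlevels x y b).
  by apply/funext => j; apply/funext => t; apply/funext => i; rewrite /lt nth_level.
by rewrite !pE !dE nlevelsE leE ltE.
Qed.

End order_invariance.

Section face_invariance.
Variables (R : realType) (T k : nat) (tau : R).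
Variables (Pobs : probability (observation R T k) R).
Variables (N : support_numbering Pobs).
Variables (I : nat) (c : 'I_I -> k.-tuple R) (e : 'I_I -> R).

(** The sign of a tie form is thus the outcome of comparing two residuals, with the roles of
    [(j, t)] and [(h, s)] exchanged. *)
Lemma tie_formE m (j h : 'I_(nouts m)) (t s : 'I_T) (b : k.-tuple R) :
  tie_form (N := N) j h t s b =
  resid (xpath N m) (outs N m) b h s - resid (xpath N m) (outs N m) b j t.
Proof.
rewrite /tie_form /resid /dot; under eq_bigr do rewrite mulrBl.
by rewrite sumrB; ring.
Qed.

Lemma same_face_invariance (b b' : k.-tuple R) : same_face N c e b b' ->
  (forall m : 'I_(npaths N),
     path_primal_feasible tau m b <-> path_primal_feasible tau m b') /\
  delta tau N b = delta tau N b'.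
Proof.
move=> [tie _].
have same_order m j t h s :
    (resid (xpath N m) (outs N m) b j t <= resid (xpath N m) (outs N m) b h s) =
    (resid (xpath N m) (outs N m) b' j t <= resid (xpath N m) (outs N m) b' h s).
  rewrite -subr_ge0 -(tie_formE j h) -sgr_ge0 tie.
  by rewrite sgr_ge0 tie_formE subr_ge0.
have H m := @order_invariance R T k tau (xpath N m) _ (outs N m)
  (fun j => outcome_prob Pobs (xpath N m) (outs N m j)) b b' (same_order m).
split=> [m|]; first by have [] := H m.
by apply: eq_bigr => m _; congr (_ * _); have [] := H m.
Qed.

End face_invariance.

(** * Conditional probabilities *)

Lemma le_measure_ae d (Om : measurableType d) (R : realType)
    (mu : {measure set Om -> \bar R}) (A B : set Om) :
  measurable A -> measurable B -> {ae mu, forall w, A w -> B w} ->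
  (mu A <= mu B)%E.
Proof.
move=> mA mB [N [mN N0 AN]].
apply: (@le_trans _ _ (mu (B `|` N))).
  rewrite le_measure ?inE//; first exact: measurableU.
  move=> w Aw; have [Bw|nBw] := pselect (B w); [by left|right].
  by apply: AN => /= AB; exact/nBw/AB.
by rewrite measureU0.
Qed.

Section conditional_probability.
Context d d' (Om : measurableType d) (S : measurableType d') (R : realType).
Variables (P : probability Om R) (W : {mfun Om >-> S}) (E : set Om).
Hypothesis mE : measurable E.

Let mW B : measurable B -> measurable (W @^-1` B).
Proof.
by move=> mB; rewrite -[X in measurable X]setTI; exact: measurable_funP.
Qed.

(** The finite measure whose density with respect to the law of [W] is P(E | W). Recognizing it as a
    pushforward of a restriction of [P] gives countable additivity. *)
Definition restricted_law (B : set S) : \bar R := P (E `&` W @^-1` B).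

Let restricted_lawE : restricted_law = pushforward (mrestr P mE) W.
Proof. by apply/funext => B; rewrite /pushforward /mrestr setIC. Qed.

Let restricted_law0 : restricted_law set0 = 0%E.
Proof. by rewrite /restricted_law preimage_set0 setI0 measure0. Qed.

Let restricted_law_ge0 B : (0 <= restricted_law B)%E.
Proof. exact: measure_ge0. Qed.

Let restricted_law_sigma_additive : semi_sigma_additive restricted_law.
Proof. by rewrite restricted_lawE; exact: measure_semi_sigma_additive. Qed.

HB.instance Definition _ := isMeasure.Build _ _ _ restricted_law
  restricted_law0 restricted_law_ge0 restricted_law_sigma_additive.

Let restricted_law_finite : fin_num_fun restricted_law.
Proof.
by move=> B mB; apply/fin_num_measure/measurableI => //; exact: mW.
Qed.

HB.instance Definition _ := @Measure_isFinite.Build _ _ _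
  restricted_law restricted_law_finite.

Lemma cond_prob_version_exists : exists g : S -> R, cond_prob_version P E W g.
Proof.
pose nu := charge_of_finite_measure restricted_law.
pose mu := distribution P W.
have numu : nu `<< mu.
  apply/null_content_dominatesP => B mB muB.
  have mWB := mW mB.
  apply: (@subset_measure0 _ _ _ P _ (W @^-1` B)) => //.
  exact: measurableI.
have gfin s : (Radon_Nikodym nu mu s) \is a fin_num by exact: Radon_Nikodym_fin_num.
have gint := Radon_Nikodym_integrable numu.
pose g s := fine (Radon_Nikodym nu mu s).
have gE : EFin \o g = Radon_Nikodym nu mu.
  by apply/funext => s; rewrite /= fineK.
have mg : measurable_fun setT g.
  by apply/measurable_EFinP; rewrite gE; exact: measurable_int gint.
have gWint : P.-integrable setT (EFin \o (g \o W)).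
  apply/integrableP; split.
    by apply/measurable_EFinP; exact: measurableT_comp.
  have /integrableP[_] := gint; rewrite -gE.
  rewrite ge0_integral_pushforward//.
  apply: measurableT_comp => //; exact/measurable_EFinP.
exists g; split=> // B mB.
apply/esym/(etrans (Radon_Nikodym_integral numu mB)).
rewrite -gE integral_pushforward//.
  exact/measurable_EFinP.
by apply: (integrableS measurableT) => //; exact: mW.
Qed.

Lemma ae_ge0_integral (h : S -> R) : measurable_fun setT h ->
  P.-integrable setT (fun w => (h (W w))%:E) ->
  {ae P, forall w, 0 <= h (W w)} <->
  forall B, measurable B -> (0 <= \int[P]_(w in W @^-1` B) (h (W w))%:E)%E.
Proof.
move=> mh hint.
have mhW : measurable_fun setT (fun w => (h (W w))%:E).
  exact: measurable_int hint.
split=> [h0 B mB|h0].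
  have mWB := mW mB; have mhB := measurable_funTS (D := W @^-1` B) mhW.
  have -> : (\int[P]_(w in W @^-1` B) (h (W w))%:E =
             \int[P]_(w in W @^-1` B) `|(h (W w))%:E|)%E.
    apply: ae_eq_integral => //; first exact: measurableT_comp.
    by apply: filterS h0 => w h0 _ /=; rewrite ger0_norm.
  by apply: integral_ge0 => w _; exact: abse_ge0.
(* On the event that [h] is negative the integral is both nonnegative and nonpositive, so [|h|]
   integrates to zero there and the event is null. *)
pose B := [set s | h s < 0].
have mB : measurable B.
  rewrite /B (_ : [set s | _] = h @^-1` `]-oo, 0[%classic).
    by rewrite -[X in measurable X]setTI; apply: mh.
  by apply/seteqP; split=> s /=; rewrite in_itv.
have : (\int[P]_(w in W @^-1` B) `|(h (W w))%:E|)%E = 0%E.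
  apply/eqP; rewrite eq_le; apply/andP; split; last first.
    by apply: integral_ge0 => w _; exact: abse_ge0.
  rewrite (eq_integral (fun w => - (h (W w))%:E)%E).
    rewrite integralN; first by rewrite oppe_le0 h0.
    apply: integrable_add_def; first exact: mW.
    by apply: (integrableS measurableT) => //; exact: mW.
  by move=> w; rewrite inE /B/= => hw; rewrite ltr0_norm.
move/(ae_eq_integral_abs _ (mW mB)) => /(_ (measurable_funTS mhW)).
apply: filterS => w hB; rewrite leNgt; apply/negP => hw.
by have := hB hw; case=> hw0; move: hw; rewrite hw0 ltxx.
Qed.

(** The affine form covers both one-sided bounds at once: [(u, v) = (a, -1)] gives the upper bound
    and [(-a, 1)] the lower one. *)
Lemma ae_affine_cond_prob (g : S -> R) (u v : R) : cond_prob_version P E W g ->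
  {ae P, forall w, 0 <= u + v * g (W w)} <->
  forall B, measurable B ->
    0 <= u * fine (P (W @^-1` B)) + v * fine (P (E `&` W @^-1` B)).
Proof.
move=> [mg gint gE].
have cint D : measurable D -> P.-integrable D (EFin \o cst u).
  exact: finite_measure_integrable_cst.
have vint D : measurable D -> P.-integrable D (fun w => v%:E * (g (W w))%:E)%E.
  by move=> mD; apply: integrableZl => //; exact: (integrableS measurableT).
have mh : measurable_fun setT (fun s => u + v * g s).
  by apply: measurable_funD => //; exact: measurable_funM.
have hint : P.-integrable setT (fun w => (u + v * g (W w))%:E).
  apply: (eq_integrable measurableT (fun w => u%:E + v%:E * (g (W w))%:E)%E) => //.
  exact: (integrableD measurableT (cint _ measurableT) (vint _ measurableT)).
have hE B : measurable B -> (\int[P]_(w in W @^-1` B) (u + v * g (W w))%:E =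
    (u * fine (P (W @^-1` B)) + v * fine (P (E `&` W @^-1` B)))%:E)%E.
  move=> mB; have mWB := mW mB.
  under eq_integral do rewrite EFinD EFinM.
  rewrite integralD//=; [|exact: cint|exact: vint].
  rewrite integral_cst// integralZl//; last exact: (integrableS measurableT).
  by rewrite gE// EFinD !EFinM !fineK// fin_num_measure//; exact: measurableI.
rewrite (ae_ge0_integral mh hint).
by split=> H B mB; have := H B mB; rewrite hE.
Qed.

Lemma cond_prob_version_le (g : S -> R) (a : R) : cond_prob_version P E W g ->
  {ae P, forall w, g (W w) <= a} <->
  forall B, measurable B ->
    fine (P (E `&` W @^-1` B)) <= a * fine (P (W @^-1` B)).
Proof.
move=> gv; have [H1 H2] := ae_affine_cond_prob a (-1) gv; split=> [H B mB|H].
  rewrite -subr_ge0 -mulN1r H1//; apply: filterS H => w.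
  by rewrite mulN1r subr_ge0.
have : {ae P, forall w, 0 <= a + -1 * g (W w)}.
  by apply: H2 => B mB; rewrite mulN1r subr_ge0 H.
by apply: filterS => w; rewrite mulN1r subr_ge0.
Qed.

Lemma cond_prob_version_ge (g : S -> R) (a : R) : cond_prob_version P E W g ->
  {ae P, forall w, a <= g (W w)} <->
  forall B, measurable B ->
    a * fine (P (W @^-1` B)) <= fine (P (E `&` W @^-1` B)).
Proof.
move=> gv; have [H1 H2] := ae_affine_cond_prob (- a) 1 gv; split=> [H B mB|H].
  rewrite -subr_ge0 addrC -mulNr -[X in _ + X]mul1r H1//; apply: filterS H => w.
  by rewrite mul1r addrC subr_ge0.
have : {ae P, forall w, 0 <= - a + 1 * g (W w)}.
  by apply: H2 => B mB; rewrite mul1r mulNr addrC subr_ge0 H.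
by apply: filterS => w; rewrite mul1r addrC subr_ge0.
Qed.

End conditional_probability.

(** * Finitely supported laws *)

Lemma le_fine_ae d (Om : measurableType d) (R : realType)
    (P : probability Om R) (A B : set Om) :
  measurable A -> measurable B -> {ae P, forall w, A w -> B w} ->
  fine (P A) <= fine (P B).
Proof.
by move=> mA mB AB; rewrite fine_le ?fin_num_measure//; exact: le_measure_ae.
Qed.

Lemma measurable_tuple1 d (S : measurableType d) n (v : n.-tuple S) :
  (forall s : S, measurable [set s]) -> measurable [set v].
Proof.
move=> mS.
rewrite (_ : [set v] =
    \bigcap_(i in [set: 'I_n]) ((@tnth n S)^~ i @^-1` [set tnth v i])).
  apply: fin_bigcap_measurable => // i _.
  by rewrite -[X in measurable X]setTI; apply: measurable_tnth.
apply/seteqP; split=> [_ -> //|w wv].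
by apply: eq_from_tnth => i; exact: wv.
Qed.

Lemma measurable_prod1 d1 d2 (S1 : measurableType d1) (S2 : measurableType d2)
    (v : S1 * S2) :
  (forall s : S1, measurable [set s]) -> (forall s : S2, measurable [set s]) ->
  measurable [set v].
Proof.
move=> m1 m2; case: v => v1 v2.
rewrite (_ : [set (v1, v2)] = [set v1] `*` [set v2]); first exact: measurableX.
by apply/seteqP; split=> [_ -> //|[w1 w2] [/= -> ->]].
Qed.

(** The cells need to cover [A] only almost surely, which is what the support points, the outcomes
    on a path and the bins for [A] provide. *)
Lemma measure_partition d (Om : measurableType d) (R : realType)
    (P : probability Om R) (I : finType) (D : I -> set Om) (A : set Om) :
  measurable A -> (forall i, measurable (D i)) ->
  (forall i j w, D i w -> D j w -> i = j) ->
  {ae P, forall w, A w -> exists i, D i w} ->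
  fine (P A) = \sum_i fine (P (A `&` D i)).
Proof.
move=> mA mD Dinj AD.
have mAD i : measurable (A `&` D i) by exact: measurableI.
have mU : measurable (\bigcup_(i in [set: I]) (A `&` D i)).
  by apply: fin_bigcup_measurable.
have -> : P A = P (\bigcup_(i in [set: I]) (A `&` D i)).
  apply/eqP; rewrite eq_le; apply/andP; split.
    apply: le_measure_ae => //; apply: filterS AD => w AD Aw.
    by have [i Di] := AD Aw; exists i.
  by rewrite le_measure ?inE// => w [i _ []].
have finI : finite_set [set: I] by [].
rewrite measure_fin_bigcup//; last first.
  by move=> i j _ _ [w [[_ Di] [_ Dj]]]; exact: Dinj Di Dj.
have -> : [set: I] = [set` enum I].
  by apply/seteqP; split=> i //= _; rewrite mem_enum.
rewrite -fsbig_seq ?enum_uniq// big_enum/= sum_fine// => i _.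
by rewrite fin_num_measure.
Qed.

(** A sum of scaled Dirac masses. Its total mass is already 1: [mnormalize] changes no value and
    only supplies the structure of a probability. *)
Lemma finite_probability d (Om : measurableType d) (R : realType) (I : finType)
    (a : I -> R) (f : I -> Om) :
  (forall i, 0 <= a i) -> \sum_i a i = 1 ->
  exists P : probability Om R,
    forall A, P A = (\sum_i a i * (f i \in A)%:R)%:E.
Proof.
move=> a0 a1.
(* Masses with sum 1 force an index to exist; its Dirac mass fills the default arguments below. *)
have [i0 _|I0] := pickP (@predT I); last first.
  by move/eqP: a1; rewrite big_pred0 ?(eq_sym 0) ?oner_eq0.
pose s : seq {measure set Om -> \bar R} :=
  [seq (mscale (NngNum (a0 i)) (@dirac _ _ (f i) R) : {measure set Om -> \bar R})
  | i <- enum I].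
pose m0 : {measure set Om -> \bar R} := @dirac _ _ (f i0) R.
pose mu : {measure set Om -> \bar R} := msum (nth m0 s) (size s).
have muE A : mu A = (\sum_i a i * (f i \in A)%:R)%:E.
  transitivity (\sum_(m <- s) m A)%E; first by rewrite (big_nth m0) big_mkord.
  rewrite big_map big_enum/= -sumEFin; apply: eq_bigr => i _.
  by rewrite /mscale/= diracE EFinM.
exists (mnormalize mu (@dirac _ _ (f i0) R)) => A.
have mu1 : mu setT = 1%E.
  by rewrite muE; under eq_bigr do rewrite in_setT mulr1; rewrite a1.
by rewrite /= /mnormalize mu1 onee_eq0 /= invr1 mule1 -muE.
Qed.

Lemma finite_probability_ae d (Om : measurableType d) (R : realType)
    (I : finType) (a : I -> R) (f : I -> Om) (P : probability Om R)
    (Q : Om -> Prop) :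
  (forall A, P A = (\sum_i a i * (f i \in A)%:R)%:E) ->
  (forall w : Om, measurable [set w]) -> (forall i, Q (f i)) ->
  {ae P, forall w, Q w}.
Proof.
move=> PE m1 Qf; exists (~` \bigcup_(i in [set: I]) [set f i]); split.
- by apply: measurableC; exact: fin_bigcup_measurable.
- rewrite PE big1// => i _; rewrite memNset ?mulr0// => /(_ _)[].
  by exists i.
- by move=> w nQ [i _ wi]; apply: nQ; rewrite /= wi.
Qed.

(** * Bins between consecutive levels *)

Section levels.
Variables (R : realType) (T k : nat) (x : T.-tuple (k.-tuple R)).
Variables (J : nat) (y : 'I_J -> T.-tuple R) (b : k.-tuple R).

Lemma resid_level j t : exists i : 'I_(nlevels x y b), resid x y b j t = level i.
Proof.
have : resid x y b j t \in levels x y b.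
  by rewrite mem_sort mem_undup; apply/fintype.imageP; exists (j, t).
move=> /(nthP 0)[i ib <-].
by exists (Ordinal ib).
Qed.

Lemma level_inj : injective (@level R T k x J y b).
Proof.
move=> i i' /eqP; rewrite /level nth_uniq ?ltn_ord// => [/eqP/val_inj//|].
by rewrite sort_uniq undup_uniq.
Qed.

(* The half-open interval from level i to the next level. *)
Definition bin (i : 'I_(nlevels x y b)) : set R :=
  [set a | level i <= a /\
    forall i' : 'I_(nlevels x y b), level i < level i' -> a < level i'].

Lemma measurable_bin i : measurable (bin i).
Proof.
rewrite (_ : bin i = `[level i, +oo[%classic `&` \bigcap_(i' in
    [set i' : 'I_(nlevels x y b) | level i < level i']) `]-oo, level i'[%classic).
  apply: measurableI; first exact: measurable_itv.
  apply: fin_bigcap_measurable => // i' _; exact: measurable_itv.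
apply/seteqP; split=> [a [ia ai]|a []] /=; rewrite in_itv/= andbT.
  by split=> // i' /ai; rewrite /= in_itv.
by move=> ia ai; split=> // i' /ai; rewrite /= in_itv.
Qed.

Lemma bin_inj i i' a : bin i a -> bin i' a -> i = i'.
Proof.
move=> [ia ai] [i'a ai']; apply: level_inj; apply/eqP; rewrite eq_le !leNgt.
apply/andP; split; apply/negP => /[dup] lt.
  by move=> /ai'; rewrite ltNge ia.
by move=> /ai; rewrite ltNge i'a.
Qed.

(** The bin of [a] starts at the greatest level not exceeding [a]. *)
Lemma bin_cover (i : 'I_(nlevels x y b)) a : level i <= a -> exists i', bin i' a.
Proof.
move=> ia; pose P (i' : 'I_(nlevels x y b)) := level i' <= a.
exists [arg max_(i' > i | P i') (level i' : R)]%O.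
case: Order.TotalTheory.arg_maxP => // i' i'a maxi'; split=> // l.
by rewrite !ltNge; apply: contra => /maxi'.
Qed.

(** Every residual is a level, and no level lies strictly above [level i] and at most at [a]. *)
Lemma bin_resid_le i a j t : bin i a -> (resid x y b j t <= a) =
  (resid x y b j t <= level i).
Proof.
move=> [ia ai]; have [l ->] := resid_level j t.
apply/idP/idP => [la|li]; last exact: le_trans ia.
by rewrite leNgt; apply/negP => /ai; rewrite ltNge la.
Qed.

(** The converse fails for a residual equal to [level i] when [a] is larger. Rounding [a] down can
    only shrink the strict event, which is the right direction for an upper bound by [tau]. *)
Lemma bin_resid_lt i a j t : bin i a -> resid x y b j t < level i ->
  resid x y b j t < a.
Proof. by move=> [ia _] /lt_le_trans; apply. Qed.

End levels.

(** * Measurability of the structural coordinates *)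

Section structural_coordinates.
Variables (R : realType) (T k : nat).

Lemma measurable_path1 (v : T.-tuple (k.-tuple R)) : measurable [set v].
Proof.
apply: measurable_tuple1 => s; apply: measurable_tuple1 => r.
exact: measurable_set1.
Qed.

Lemma measurable_outcome1 (v : T.-tuple R) : measurable [set v].
Proof. by apply: measurable_tuple1 => r; exact: measurable_set1. Qed.

Lemma measurable_observation1 (v : observation R T k) : measurable [set v].
Proof. exact: measurable_prod1 measurable_outcome1 measurable_path1. Qed.

Lemma measurable_structural1 (v : structural R T k) : measurable [set v].
Proof.
apply: measurable_prod1; first exact: measurable_observation1.
move=> s; apply: measurable_prod1; first exact: measurable_set1.
exact: measurable_outcome1.
Qed.

Lemma measurable_coordY : measurable_fun setT (@coordY R T k).
Proof. exact: measurableT_comp. Qed.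

Lemma measurable_coordXA : measurable_fun setT (@coordXA R T k).
Proof. by apply: measurable_fun_pair; exact: measurableT_comp. Qed.

HB.instance Definition _ := isMeasurableFun.Build _ _ _ _ (@coordXA R T k)
  measurable_coordXA.

Lemma measurable_coordU (t : 'I_T) : measurable_fun setT
  (fun w : structural R T k => tnth (coordU w) t).
Proof.
apply: (measurableT_comp (measurable_tnth t)).
exact: measurableT_comp.
Qed.

Lemma measurable_coordU_le (t : 'I_T) :
  measurable [set w : structural R T k | tnth (coordU w) t <= 0].
Proof.
have := measurable_coordU t measurableT (measurable_itv `]-oo, (0 : R)]).
by rewrite setTI; congr measurable; apply/seteqP; split=> w /=; rewrite in_itv.
Qed.

Lemma measurable_coordU_lt (t : 'I_T) :
  measurable [set w : structural R T k | tnth (coordU w) t < 0].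
Proof.
have := measurable_coordU t measurableT (measurable_itv `]-oo, (0 : R)[).
by rewrite setTI; congr measurable; apply/seteqP; split=> w /=; rewrite in_itv.
Qed.

End structural_coordinates.

(** * Support of the observed law *)

Section observed_support.
Variables (R : realType) (T k : nat) (Pobs : probability (observation R T k) R).
Variable N : support_numbering Pobs.

Definition support_point (m : 'I_(npaths N)) (j : 'I_(nouts m)) :
    observation R T k := (outs N m j, xpath N m).

(** Stated with dependent pairs because the type of [j] depends on [m]; it makes the atoms of the
    observed law disjoint. *)
Lemma support_point_inj m (j : 'I_(nouts m)) m' (j' : 'I_(nouts m')) w :
  w = support_point j -> w = support_point j' ->
  existT (fun m => 'I_(nouts m)) m j = existT (fun m => 'I_(nouts m)) m' j'.
Proof.
move=> -> [+ /(@xpath_inj _ _ _ _ N) mm'].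
by case: _ / mm' j' => j' /(@outs_inj _ _ _ _ N) ->.
Qed.

Lemma measurable_path_event (x : T.-tuple (k.-tuple R)) :
  measurable [set w : observation R T k | w.2 = x].
Proof.
rewrite -[X in measurable X]setTI.
exact: (@measurable_snd _ _ (T.-tuple R) _ measurableT _ (measurable_path1 x)).
Qed.

Lemma path_prob_gt0 (m : 'I_(npaths N)) : 0 < path_prob Pobs (xpath N m).
Proof. by apply/xpath_pos; exists m. Qed.

Lemma outcome_prob_gt0 (m : 'I_(npaths N)) (j : 'I_(nouts m)) :
  0 < outcome_prob Pobs (xpath N m) (outs N m j).
Proof. by apply/outs_pos; exists j. Qed.

Lemma outcome_probE x y : path_prob Pobs x != 0 ->
  path_prob Pobs x * outcome_prob Pobs x y = fine (Pobs [set (y, x)]).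
Proof.
move=> x0; rewrite /outcome_prob mulrC divfK//; congr (fine (Pobs _)).
by apply/seteqP; split=> [[w1 w2] /= [-> ->]|_ ->].
Qed.

Hypothesis Pobs_fin : has_finite_support Pobs.

Lemma observed_ae : {ae Pobs, forall w, exists m (j : 'I_(nouts m)),
  w = support_point j}.
Proof.
have [S finS S1] := Pobs_fin.
(* Besides the complement of [S], the finitely many points of [S] without mass are discarded. Any
   remaining point has positive mass, so its path and its outcome are both numbered. *)
pose Z : set (observation R T k) := S `&` [set w | Pobs [set w] = 0%E].
have finZ : finite_set Z by exact: finite_setIl.
have m1 := @measurable_observation1 R T k.
have mS : measurable S.
  by apply: countable_measurable => //; exact: finite_set_countable.
have mZ : measurable Z.
  by apply: countable_measurable => //; exact: finite_set_countable.
have Z0 : Pobs Z = 0%E.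
  rewrite (_ : Z = \bigcup_(w in Z) [set w]); last first.
    by apply/seteqP; split=> [w Zw|w [_ Zw ->//]]; exists w.
  rewrite measure_fin_bigcup//; last by move=> v w _ _ [u [-> ->]].
  by rewrite fsbig1// => w [].
have S0 : Pobs (~` S) = 0%E by rewrite probability_setC// S1 subee.
have mSC : measurable (~` S) by exact: measurableC.
exists (~` S `|` Z); split; first exact: measurableU.
  by rewrite measureU0.
move=> w /= nw; apply: contrapT => /not_orP[/contrapT Sw nZw]; apply: nw.
  have Pw : 0 < fine (Pobs [set w]).
    rewrite lt_neqAle fine_ge0// andbT eq_sym; apply/eqP => Pw0; apply: nZw.
    by split=> //=; rewrite -[LHS]fineK ?Pw0// fin_num_measure.
  case: w Sw nZw Pw => y x Sw nZw Pw.
  have px : 0 < path_prob Pobs x.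
    apply: lt_le_trans Pw _; apply: le_fine_ae => //.
      exact: measurable_path_event.
    by apply: aeW => _ ->.
  have [m mx] := (xpath_pos N x).1 px.
  have [|j jy] := (outs_pos (s := N) m y).1.
    rewrite mx -(pmulr_rgt0 _ px) outcome_probE//.
    by rewrite gt_eqF.
  by exists m, j; rewrite /support_point mx jy.
Qed.

(** A path without outcomes would be null by [observed_ae], against its positive probability. *)
Lemma nouts_gt0 (m : 'I_(npaths N)) : (0 < nouts m)%N.
Proof.
rewrite lt0n; apply/eqP => J0; have := path_prob_gt0 m; rewrite lt_neqAle.
case/andP => /eqP[]; rewrite /path_prob.
suff : fine (Pobs [set w | w.2 = xpath N m]) <= fine (Pobs set0).
  rewrite measure0 => le0; apply/eqP; rewrite eq_le le0/= fine_ge0//.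
apply: le_fine_ae => //.
  exact: measurable_path_event.
apply: filterS observed_ae => w [m' [j ->]] /= /(@xpath_inj _ _ _ _ N) mm'.
case: _ / (esym mm') j => j; have := ltn_ord j.
by move: (nat_of_ord j) => n; rewrite J0.
Qed.

End observed_support.

(** * Rationalizing laws and primal feasibility *)

Section necessity.
Variables (R : realType) (T k : nat) (tau : R).
Variables (Pobs : probability (observation R T k) R).
Variable N : support_numbering Pobs.
Hypothesis Pobs_fin : has_finite_support Pobs.
Variable b : k.-tuple R.

Variable Ps : probability (structural R T k) R.
Hypothesis Ps_rat : rationalizes tau Pobs b Ps.
Hypotheses (T_gt0 : (0 < T)%N) (tau_gt0 : 0 < tau).
Variable m : 'I_(npaths N).

Let z := resid (xpath N m) (outs N m) b.
Let n := nlevels (xpath N m) (outs N m) b.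
Let lev (i : 'I_n) : R := level i.
Let out (j : 'I_(nouts m)) := [set w : structural R T k | coordY w = outs N m j].
Let cell (i : 'I_n) := @coordXA R T k @^-1` ([set xpath N m] `*` bin i).

Let measurable_out j : measurable (out j).
Proof.
rewrite -[X in measurable X]setTI.
exact: (@measurable_coordY R T k measurableT _ (measurable_outcome1 (outs N m j))).
Qed.

Let measurable_XA (B : set R) : measurable B ->
  measurable ([set xpath N m] `*` B).
Proof. by move=> mB; apply: measurableX => //; exact: measurable_path1. Qed.

Let measurable_preXA (B : set R) : measurable B ->
  measurable (@coordXA R T k @^-1` ([set xpath N m] `*` B)).
Proof.
move=> mB; rewrite -[X in measurable X]setTI.
exact: (measurable_coordXA measurableT (measurable_XA mB)).
Qed.

Let measurable_cell i : measurable (cell i).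
Proof. by apply: measurable_preXA; exact: measurable_bin. Qed.

(** On path [m], the sign of [U_t] is almost surely the comparison of a residual with [A]. *)
Let path_ae t : {ae Ps, forall w, coordX w = xpath N m ->
  exists j, out j w /\ tnth (coordU w) t = z j t - coordA w}.
Proof.
have [marg eqn _ _] := Ps_rat.
have [Z [mZ Z0 obsZ]] := observed_ae N Pobs_fin.
have fibre : {ae Ps, forall w, exists (m' : 'I_(npaths N)) (j : 'I_(nouts m')),
    w.1 = support_point j}.
  exists (fst @^-1` Z); split; last by move=> w nw; exact: (obsZ w.1 nw).
    rewrite -[X in measurable X]setTI.
    exact: (@measurable_fst _ _ (observation R T k) _ measurableT _ mZ).
  by rewrite marg.
apply: filterS2 fibre (eqn t) => w [m' [j wj]] Yt Xm.
have : xpath N m' = xpath N m by rewrite -Xm /coordX wj.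
move=> /(@xpath_inj _ _ _ _ N) mm'; subst m'.
exists j; rewrite /out /= /coordY wj; split=> //.
by move: Yt; rewrite /z /resid -Xm /coordY wj /= => ->; ring.
Qed.

Let cond_le (t : 'I_T) B : measurable B ->
  tau * fine (Ps (@coordXA R T k @^-1` B)) <=
  fine (Ps ([set w | tnth (coordU w) t <= 0] `&` @coordXA R T k @^-1` B)).
Proof.
have [_ _ /(_ t)[g [gv gtau]] _] := Ps_rat.
exact: (cond_prob_version_ge (measurable_coordU_le t) tau gv).1.
Qed.

Let cond_lt (t : 'I_T) B : measurable B ->
  fine (Ps ([set w | tnth (coordU w) t < 0] `&` @coordXA R T k @^-1` B)) <=
  tau * fine (Ps (@coordXA R T k @^-1` B)).
Proof.
have [_ _ _ /(_ t)[g [gv gtau]]] := Ps_rat.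
exact: (cond_prob_version_le (measurable_coordU_lt t) tau gv).1.
Qed.

(* No mass below the lowest level: there the event U_t <= 0 is impossible. *)
Let bin_ae : {ae Ps, forall w, coordX w = xpath N m ->
  exists i : 'I_n, bin i (coordA w)}.
Proof.
pose low : set R := \bigcap_(i in [set: 'I_n]) `]-oo, lev i[%classic.
have mlow : measurable low.
  by apply: fin_bigcap_measurable => // i _; exact: measurable_itv.
have mC := measurable_preXA mlow.
pose t0 := Ordinal T_gt0.
exists (@coordXA R T k @^-1` ([set xpath N m] `*` low)); split=> //.
  (* The lower quantile bound on this event reads [tau * P(low) <= 0], since [U_t] is positive
     there; with [tau > 0] the event is null. *)
  have := cond_le t0 (measurable_XA mlow).
  have : fine (Ps ([set w | tnth (coordU w) t0 <= 0] `&`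
      @coordXA R T k @^-1` ([set xpath N m] `*` low))) <= fine (Ps set0).
    apply: le_fine_ae => //.
      by apply: measurableI => //; exact: measurable_coordU_le.
    apply: filterS (path_ae t0) => w Hw [/= U0 [/= Xm Alow]].
    have [j [_ Uz]] := Hw Xm.
    have [i zi] := resid_level (xpath N m) (outs N m) b j t0.
    have := Alow i Logic.I; rewrite /= in_itv/= /lev -zi -/(z j t0).
    by move: U0; rewrite Uz subr_le0 leNgt => /negPf->.
  rewrite measure0 /= => h1 h2; have := le_trans h2 h1.
  rewrite pmulr_rle0// => h3.
  rewrite -[LHS]fineK ?fin_num_measure//; congr (_%:E).
  by apply/eqP; rewrite eq_le h3 fine_ge0.
move=> w /= /not_implyP[Xm nbin]; split=> // i _ /=.
rewrite in_itv/= ltNge; apply/negP => iA; apply: nbin.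
exact: bin_cover iA.
Qed.

Lemma rationalizes_primal_feasible : path_primal_feasible tau m b.
Proof.
have pi0 := path_prob_gt0 m.
pose q (j : 'I_(nouts m)) (i : 'I_n) :=
  fine (Ps (cell i `&` out j)) / path_prob Pobs (xpath N m).
have mco j i : measurable (cell i `&` out j) by exact: measurableI.
have qpi (Q : pred 'I_(nouts m)) i : \sum_(j | Q j) q j i =
    (\sum_(j | Q j) fine (Ps (cell i `&` out j))) / path_prob Pobs (xpath N m).
  by rewrite mulr_suml.
have out_inj j j' w : out j w -> out j' w -> j = j'.
  by move=> wj wj'; apply: (@outs_inj _ _ _ _ N m); exact: etrans (esym wj) wj'.
have out_cell i (A : set (structural R T k)) : measurable A ->
    fine (Ps (A `&` cell i)) = \sum_j fine (Ps (A `&` cell i `&` out j)).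
  move=> mA; apply: measure_partition => //; first exact: measurableI.
  apply: filterS (path_ae (Ordinal T_gt0)) => w Hw [_ [Xm _]].
  by have [j [? _]] := Hw Xm; exists j.
have sum_cell i : \sum_j fine (Ps (cell i `&` out j)) = fine (Ps (cell i)).
  by have := out_cell i setT measurableT; rewrite !setTI => <-.
exists (\matrix_(j, i) q j i); split=> [j i|j|i t|i t].
- by rewrite mxE; apply: divr_ge0; [exact: fine_ge0|exact: ltW].
- under eq_bigr do rewrite mxE.
  rewrite -mulr_suml; apply/(canLR (mulfK (lt0r_neq0 pi0))).
  rewrite [RHS]mulrC outcome_probE ?gt_eqF//.
  have [marg _ _ _] := Ps_rat.
  rewrite -marg; last exact: measurable_observation1.
  (* The row sum splits the event [(Y, X) = (y_j, x^m)] according to the bin of [A]; by [bin_ae] no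
     mass escapes. *)
  rewrite (@measure_partition _ _ _ Ps _ (fun i : 'I_n =>
    @coordXA R T k @^-1` (setT `*` bin i)))//.
  + apply: eq_bigr => i _; congr (fine (Ps _)).
    apply/seteqP; split=> -[[w1 w2] w3].
      by move=> [[Xm Ab] Yj]; split; [exact: (f_equal2 pair Yj Xm)|split].
    by move=> [[Yj Xm] [_ Ab]].
  + rewrite -[X in measurable X]setTI.
    apply: (@measurable_fst _ _ (observation R T k) _ measurableT).
    exact: measurable_observation1.
  + move=> i; rewrite -[X in measurable X]setTI.
    apply: (measurable_coordXA measurableT).
    by apply: measurableX => //; exact: measurable_bin.
  + by move=> i i' w [_ wi] [_ wi']; exact: bin_inj wi wi'.
  + apply: filterS bin_ae => w Hw /= wj.
    by have [|i Ai] := Hw; [rewrite /coordX wj|exists i].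
- under eq_bigr do rewrite mxE.
  under [X in _ <= X]eq_bigr do rewrite mxE.
  rewrite !qpi mulrA ler_wpM2r ?invr_ge0 ?(ltW pi0)// sum_cell.
  apply: le_trans (cond_le t (measurable_XA (measurable_bin i))) _.
  rewrite (out_cell i)//; last exact: measurable_coordU_le.
  rewrite [leRHS]big_mkcond; apply: ler_sum => j _.
  have mU : measurable ([set w | tnth (coordU w) t <= 0] `&` cell i `&` out j).
    apply: measurableI => //; apply: measurableI => //.
    exact: measurable_coordU_le.
  case: ifPn => zi; first by apply: le_fine_ae => //; apply: aeW => w [[_ ?] ?].
  (* If the residual exceeds level [i], it exceeds every [A] in the bin, so [U_t <= 0] is almost
     surely excluded. *)
  rewrite -[leRHS]/(fine 0%E) -(measure0 Ps); apply: le_fine_ae => //.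
  apply: filterS (path_ae t) => w Hw [[/= U0 [/= Xm Ai]] wj].
  have [j' [wj' Uz]] := Hw Xm; move/negP: zi; apply.
  by rewrite -(bin_resid_le _ _ Ai) (out_inj _ _ _ wj wj') -subr_le0 -/(z j' t) -Uz.
- under eq_bigr do rewrite mxE.
  under [X in _ <= _ * X]eq_bigr do rewrite mxE.
  rewrite !qpi mulrA ler_wpM2r ?invr_ge0 ?(ltW pi0)// sum_cell.
  apply: le_trans (cond_lt t (measurable_XA (measurable_bin i))).
  rewrite (out_cell i)//; last exact: measurable_coordU_lt.
  rewrite [leLHS]big_mkcond; apply: ler_sum => j _.
  have mU : measurable ([set w | tnth (coordU w) t < 0] `&` cell i `&` out j).
    apply: measurableI => //; apply: measurableI => //.
    exact: measurable_coordU_lt.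
  case: ifPn => zi; last by rewrite fine_ge0.
  (* A residual below level [i] is below every [A] in the bin, so almost all of this cell has
     [U_t < 0]. *)
  apply: le_fine_ae => //; apply: filterS (path_ae t) => w Hw [[/= Xm Ai] wj].
  have [j' [wj' Uz]] := Hw Xm; split=> //; split=> //=.
  rewrite Uz subr_lt0 -(out_inj _ _ _ wj wj').
  exact: bin_resid_lt Ai zi.
Qed.

End necessity.

(** * From primal solutions to a rationalizing law *)

Lemma mem_preimage (A B : Type) (f : A -> B) (D : set B) a :
  (a \in f @^-1` D) = (f a \in D).
Proof. by apply/idP/idP; rewrite !inE. Qed.

Section sufficiency.
Variables (R : realType) (T k : nat) (tau : R).
Variables (Pobs : probability (observation R T k) R).
Variable N : support_numbering Pobs.
Hypothesis Pobs_fin : has_finite_support Pobs.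
Variable b : k.-tuple R.
Hypothesis feas : forall m : 'I_(npaths N), path_primal_feasible tau m b.

Let n (m : 'I_(npaths N)) := nlevels (xpath N m) (outs N m) b.
Let z (m : 'I_(npaths N)) j t := resid (xpath N m) (outs N m) b j t.
Let lev (m : 'I_(npaths N)) (i : 'I_(n m)) : R := level i.

(* The effect A sits on the levels, with conditional masses given by the
   primal solutions. *)
Let index := {m : 'I_(npaths N) & ('I_(nouts m) * 'I_(n m))%type}.

Let atom (s : index) : structural R T k :=
  let: existT m (j, i) := s in
  (support_point j, (lev i, [tuple z j t - lev i | t < T])).

Let q (m : 'I_(npaths N)) : 'M[R]_(nouts m, n m) := sval (cid (feas m)).

Let qP (m : 'I_(npaths N)) := svalP (cid (feas m)).

Let mass (s : index) : R :=
  let: existT m (j, i) := s in path_prob Pobs (xpath N m) * q m j i.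

Let mass_ge0 s : 0 <= mass s.
Proof.
case: s => m [j i] /=; have [q0 _ _ _] := qP m.
by rewrite mulr_ge0// ltW// path_prob_gt0.
Qed.

Let sum_index (F : index -> R) :
  \sum_s F s = \sum_m \sum_j \sum_i F (existT _ m (j, i)).
Proof.
rewrite -(eq_bigr _ (fun m _ => esym (pair_bigA _ _)))/=.
by rewrite sig_big_dep/=; apply: eq_bigr => -[m [j i]].
Qed.

(** Summing out the levels leaves the observed point masses, since row [j] of [q m] sums to the
    conditional probability of outcome [j]. This yields both the total mass 1 and the
    [(Y, X)]-marginal. *)
Let sum_support (F : observation R T k -> R) :
  \sum_s mass s * F (atom s).1 =
  \sum_(s : {m : 'I_(npaths N) & 'I_(nouts m)})
     fine (Pobs [set support_point (tagged s)]) * F (support_point (tagged s)).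
Proof.
rewrite sum_index; transitivity (\sum_m \sum_j
    fine (Pobs [set support_point j]) * F (@support_point _ _ _ _ N m j)).
  apply: eq_bigr => m _; apply: eq_bigr => j _; have [_ qp _ _] := qP m.
  rewrite /= -mulr_suml -mulr_sumr qp outcome_probE// gt_eqF//.
  exact: path_prob_gt0.
by rewrite sig_big_dep.
Qed.

Let obs_partition (B : set (observation R T k)) : measurable B ->
  fine (Pobs B) = \sum_(s : {m : 'I_(npaths N) & 'I_(nouts m)})
     fine (Pobs [set support_point (tagged s)]) *
     (support_point (tagged s) \in B)%:R.
Proof.
move=> mB; rewrite (@measure_partition _ _ _ Pobs _
  (fun s : {m : 'I_(npaths N) & 'I_(nouts m)} =>
     [set support_point (tagged s)]))//.
- apply: eq_bigr => s _; case: (boolP (_ \in B)) => [|/negP]; rewrite inE => sB.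
    by rewrite mulr1; congr (fine (Pobs _)); apply/setIidr => _ ->.
  rewrite mulr0 (_ : _ `&` _ = set0) ?measure0//.
  by apply/seteqP; split=> // w [Bw ws]; apply: sB; rewrite -ws.
- by move=> s; exact: measurable_observation1.
- by move=> [m j] [m' j'] w /= wj wj'; exact: support_point_inj wj wj'.
- apply: filterS (observed_ae N Pobs_fin) => w [m [j wj]] _.
  by exists (existT _ m j).
Qed.

Lemma primal_feasible_rationalizes : exists Ps, rationalizes tau Pobs b Ps.
Proof.
have mass1 : \sum_s mass s = 1.
  have := sum_support (fun=> 1); rewrite -(eq_bigr _ (fun s _ => esym (mulr1 _))).
  move=> ->; transitivity (fine (Pobs setT)); last by rewrite probability_setT.
  by rewrite obs_partition//; apply: eq_bigr => s _; rewrite in_setT.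
have [Ps PsE] := finite_probability atom mass_ge0 mass1.
have atomXA m (j : 'I_(nouts m)) (i : 'I_(n m)) :
    coordXA (atom (existT _ m (j, i))) = (xpath N m, lev i) by [].
have atomU m (j : 'I_(nouts m)) (i : 'I_(n m)) t :
    tnth (coordU (atom (existT _ m (j, i)))) t = z j t - lev i.
  by rewrite /coordU/= tnth_mktuple.
(* An event on [(X, A)] depends on the atom only through [(m, i)]. Its indicator [C] therefore
   factors out of the sum over outcomes, and the bound on an arbitrary Borel set is a nonnegative
   combination of primal constraints. *)
have cell_sum (Q : index -> bool) (C : forall m, 'I_(n m) -> bool)
    (D : forall m, 'I_(nouts m) -> 'I_(n m) -> bool) :
    (forall m j i, Q (existT _ m (j, i)) = D m j i && C m i) ->
    \sum_s mass s * (Q s)%:R = \sum_m path_prob Pobs (xpath N m) *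
      \sum_i (C m i)%:R * \sum_(j | D m j i) q m j i.
  move=> QE; rewrite sum_index; apply: eq_bigr => m _.
  rewrite exchange_big mulr_sumr; apply: eq_bigr => i _.
  rewrite [in RHS]big_mkcond !mulr_sumr; apply: eq_bigr => j _ /=.
  rewrite QE; case: (D m j i); case: (C m i);
    by rewrite /= ?mul1r ?mulr1 ?mul0r ?mulr0.
have PXA B : fine (Ps (@coordXA R T k @^-1` B)) =
    \sum_m path_prob Pobs (xpath N m) *
      \sum_i ((xpath N m, lev i) \in B)%:R * \sum_j q m j i.
  rewrite PsE; under eq_bigr do rewrite mem_preimage.
  exact: (cell_sum (fun s => coordXA (atom s) \in B)
    (fun m i => (xpath N m, lev i) \in B) (fun _ _ _ => true)).
exists Ps; split.
- move=> B mB; rewrite PsE -[RHS]fineK ?fin_num_measure// obs_partition//.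
  congr _%:E; rewrite -(sum_support (fun w => (w \in B)%:R)).
  by apply: eq_bigr => s _; rewrite mem_preimage.
- move=> t; apply: (finite_probability_ae PsE (@measurable_structural1 R T k)).
  move=> [m [j i]]; rewrite atomU /= /z /resid /coordY /coordX /coordA /=; ring.
- move=> t; have mE := @measurable_coordU_le R T k t.
  have [g gv] := cond_prob_version_exists Ps (@coordXA R T k) mE.
  exists g; split=> //; apply/(cond_prob_version_ge mE tau gv) => B mB.
  rewrite PXA PsE/=; under [leRHS]eq_bigr do rewrite in_setI mem_preimage.
  rewrite (cell_sum (fun s => (atom s \in _) && (coordXA (atom s) \in B))
    (fun m i => (xpath N m, lev i) \in B)
    (fun m j i => z j t <= lev i)) => [|m j i].
    rewrite mulr_sumr; apply: ler_sum => m _; have [_ _ qle _] := qP m.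
    rewrite mulrCA ler_wpM2l ?(ltW (path_prob_gt0 m))// mulr_sumr.
    apply: ler_sum => i _; rewrite mulrCA.
    by apply: ler_wpM2l; [exact: ler0n|exact: qle].
  rewrite atomXA; congr (_ && _).
  by apply/idP/idP; rewrite inE /= tnth_mktuple subr_le0.
- move=> t; have mE := @measurable_coordU_lt R T k t.
  have [g gv] := cond_prob_version_exists Ps (@coordXA R T k) mE.
  exists g; split=> //; apply/(cond_prob_version_le mE tau gv) => B mB.
  rewrite PXA PsE/=; under [leLHS]eq_bigr do rewrite in_setI mem_preimage.
  rewrite (cell_sum (fun s => (atom s \in _) && (coordXA (atom s) \in B))
    (fun m i => (xpath N m, lev i) \in B)
    (fun m j i => z j t < lev i)) => [|m j i].
    rewrite mulr_sumr; apply: ler_sum => m _; have [_ _ _ qlt] := qP m.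
    rewrite [leRHS]mulrCA ler_wpM2l ?(ltW (path_prob_gt0 m))// mulr_sumr.
    apply: ler_sum => i _; rewrite [leRHS]mulrCA.
    by apply: ler_wpM2l; [exact: ler0n|exact: qlt].
  rewrite atomXA; congr (_ && _).
  by apply/idP/idP; rewrite inE /= tnth_mktuple subr_lt0.
Qed.

End sufficiency.

(** * The zero set of [delta] and its decomposition into faces *)

Lemma delta_eq0 (R : realType) (T k : nat) (tau : R) (T_gt0 : (0 < T)%N)
    (tau_gt0 : 0 < tau) (tau_lt1 : tau < 1)
    (Pobs : probability (observation R T k) R)
    (Pobs_fin : has_finite_support Pobs) (N : support_numbering Pobs)
    (b : k.-tuple R) :
  delta tau N b = 0 <-> forall m : 'I_(npaths N), path_primal_feasible tau m b.
Proof.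
have p0 m (j : 'I_(nouts m)) : 0 <= outcome_prob Pobs (xpath N m) (outs N m j).
  exact/ltW/outcome_prob_gt0.
(* A path has an outcome and there is a period, hence there is a residual and a level. *)
have n0 m : (0 < nlevels (xpath N m) (outs N m) b)%N.
  have [i _] := resid_level (xpath N m) (outs N m) b
    (Ordinal (nouts_gt0 Pobs_fin m)) (Ordinal T_gt0).
  exact: leq_ltn_trans (leq0n i) (ltn_ord i).
have dP m := dual_value_eq0 (p0 m) (n0 m) (ltW tau_gt0) (ltW tau_lt1).
have d0 m := dual_value_le0 (p0 m) (n0 m) (ltW tau_gt0) (ltW tau_lt1).
split=> [delta0 m|feas]; last first.
  rewrite /delta big1// => m _.
  by rewrite /path_dual_value ((dP m).2 (feas m)) mulr0.
apply/(dP m).1; have /eqP := delta0.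
(* After the sign change all summands are nonnegative, so a zero sum makes each of them zero; the
   positive path probability then cancels. *)
rewrite -oppr_eq0 /delta -sumrN psumr_eq0 => [|m' _].
  move=> /allP/(_ m (mem_index_enum _))/=; rewrite oppr_eq0 mulf_eq0.
  by rewrite (gt_eqF (path_prob_gt0 m)) => /eqP.
by rewrite -mulrN mulr_ge0// ?oppr_ge0 ?(d0 m')// ltW// path_prob_gt0.
Qed.

Theorem proposition6p6 (R : realType) (T k : nat) (tau : R)
    (T_gt0 : (0 < T)%N) (k_gt0 : (0 < k)%N) (tau_gt0 : 0 < tau) (tau_lt1 : tau < 1)
    (Pobs : probability (observation R T k) R)
    (Pobs_fin : has_finite_support Pobs)
    (N : support_numbering Pobs)
    (I : nat) (c : 'I_I -> k.-tuple R) (e : 'I_I -> R) :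
  (forall F : set (k.-tuple R), faces N c e F ->
    forall b b' : k.-tuple R, F b -> F b' ->
    [/\ forall m : 'I_(npaths N),
          path_primal_feasible tau m b <-> path_primal_feasible tau m b',
        delta tau N b = delta tau N b' &
        criterion tau N b = criterion tau N b']) /\
  (forall bF : set (k.-tuple R) -> k.-tuple R,
    (forall F : set (k.-tuple R), faces N c e F -> F (bF F)) ->
    identified_set tau Pobs (polyhedron c e) =
      \bigcup_(F in [set F | faces N c e F /\ delta tau N (bF F) = 0]) F).
Proof.
(* Two members of a face are compared through the point [b0] that generates it. *)
have face_const F : faces N c e F -> forall b b', F b -> F b' ->
    same_face N c e b b'.
  move=> [b0 _ ->] b b' [_ [tb cb]] [_ [tb' cb']].
  by split=> *; [rewrite -tb tb'|rewrite -cb cb'].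
split=> [F FF b b' Fb Fb'|bF bFP].
  have [fE dE] := same_face_invariance tau (face_const F FF b b' Fb Fb').
  by split=> //; rewrite /criterion dE.
apply/seteqP; split=> b.
  move=> [Bb [Ps Psb]].
  (* The face generated by [b] itself contains [b], and [delta] takes the same value at its chosen
     point. *)
  pose F := [set b' | polyhedron c e b' /\ same_face N c e b b'].
  have FF : faces N c e F by exists b.
  have Fb : F b by split.
  exists F => //; split=> //.
  have [_ <-] := same_face_invariance tau (face_const F FF b _ Fb (bFP F FF)).
  apply/delta_eq0 => // m; exact: rationalizes_primal_feasible Psb _ _ _.
move=> [F [FF dF] Fb].
have [_ dE] := same_face_invariance tau (face_const F FF b _ Fb (bFP F FF)).
split; first by case: FF Fb => b0 _ -> [].
apply: (primal_feasible_rationalizes Pobs_fin (N := N)).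
by apply/delta_eq0; rewrite ?dE.
Qed.
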